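(* Consider an additive noise model $Y=X+Z\in\mathbb{R}^n$ where the random variables $X,Z$ are independent and $Z$ has density $p_Z(z)\propto\exp\left(-\frac{\|z\|^2}{2\sigma^2}\right)$ with $\sigma>0$. Then for any prior probability distribution $p_X$ of $X$ on $\mathbb{R}^n$ there is a (possibly nonconvex) proper penalty $\tilde\varphi_X:\mathbb{R}^n\to\mathbb{R}\cup\{+\infty\}$, depending on $p_X$ and the variance $\sigma^2$, such that for any $y\in\mathbb{R}^n$ $$\mathbb{E}(X|Y=y)\in\arg\min_{x\in\mathbb{R}^n}\left\{\tfrac12\|y-x\|^2+\tilde\varphi_X(x)\right\}.\qquad( * )$$ Further, if $X$ is non-degenerate then the function $y\mapsto\mathbb{E}(X|Y=y)$ is injective and there is a choice of $\tilde\varphi_X$ such that for any $y\in\mathbb{R}^n$, $\mathbb{E}(X|Y=y)$ is the unique stationary point (and global minimizer) of the function $x\mapsto\frac12\|y-x\|^2+\tilde\varphi_X(x)$ minimized in $( * )$; hence $y\mapsto\mathbb{E}(X|Y=y)$ is the proximity operator of $\tilde\varphi_X$.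
   Context: $\|\cdot\|$ is the Euclidean norm. A random variable $X$ with values in $\mathbb{R}^n$ and probability distribution $P$ is non-degenerate if there is no affine hyperplane containing $X$ almost surely, i.e. if $P(\langle X,v\rangle=d)<1$ for all nonzero $v\in\mathbb{R}^n$ and all $d\in\mathbb{R}$. The conditional expectation is given pointwise by $$\mathbb{E}(X|Y=y)=\frac{\mathbb{E}_X\left(X\,p_Z(y-X)\right)}{\mathbb{E}_X\left(p_Z(y-X)\right)},\quad y\in\mathbb{R}^n .$$ A function with values in $\mathbb{R}\cup\{+\infty\}$ is proper if it is not identically $+\infty$. The proximity operator of a proper function $\varphi:\mathbb{R}^n\to\mathbb{R}\cup\{+\infty\}$ is the set-valued map $\mathrm{prox}_\varphi(y)=\arg\min_{x}\{\frac12\|y-x\|^2+\varphi(x)\}$; a function $f$ ''is'' the proximity operator of $\varphi$ when $\mathrm{prox}_\varphi(y)=\{f(y)\}$ for all $y$. A point $u$ is a stationary point of $\varrho:\mathbb{R}^n\to\mathbb{R}\cup\{+\infty\}$ if $\varrho$ is finite in a neighborhood of $u$, differentiable at $u$, and $\nabla\varrho(u)=0$. *)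

(* Defs.v *)
(* MathComp-Analysis; R^n is ['rV[R]_n] for [R : realType]. *)
From HB Require Import structures.
From mathcomp Require Import all_boot all_order all_algebra.
From mathcomp Require Import all_classical all_reals all_analysis.

Set Implicit Arguments.
Unset Strict Implicit.
Unset Printing Implicit Defensive.

Import Order.TTheory GRing.Theory Num.Theory.
Import numFieldNormedType.Exports.

Local Open Scope classical_set_scope.
Local Open Scope ring_scope.

Definition measure_rV_display : measure_display -> measure_display.
Proof. exact. Qed.

(* Row vectors carry the product sigma-algebra, as tuples do in the library;
   over a [realType] it is the Borel sigma-algebra. *)
Section measurable_rV.
Context {d} {T : measurableType d} (n : nat).

Let coor (i : 'I_n) (v : 'rV[T]_n) : T := v ord0 i.

Let rV_set0 : g_sigma_preimage coor set0.
Proof. exact: sigma_algebra0. Qed.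

Let rV_setC A : g_sigma_preimage coor A -> g_sigma_preimage coor (~` A).
Proof. exact: sigma_algebraC. Qed.

Let rV_bigcup (F : _^nat) : (forall i, g_sigma_preimage coor (F i)) ->
  g_sigma_preimage coor (\bigcup_i (F i)).
Proof. exact: sigma_algebra_bigcup. Qed.

HB.instance Definition _ := @isMeasurable.Build (measure_rV_display d)
  'rV[T]_n (g_sigma_preimage coor) rV_set0 rV_setC rV_bigcup.

End measurable_rV.

Lemma measurable_coor d (T : measurableType d) n (i : 'I_n) :
  measurable_fun [set: 'rV[T]_n] (fun v : 'rV[T]_n => v ord0 i).
Proof.
move=> _ Y mY; rewrite setTI; apply: sub_sigma_algebra => /=.
rewrite -bigcup_seq/=; exists i => /=; first by rewrite mem_index_enum.
by exists Y => //; rewrite setTI.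
Qed.

Lemma measurable_fun_rVP d1 d2 (T1 : measurableType d1) (T2 : measurableType d2)
    n (f : T1 -> 'rV[T2]_n) :
  measurable_fun [set: T1] f <->
  forall i, measurable_fun [set: T1] (fun x => f x ord0 i).
Proof.
split=> [mf i|mf _ A mA].
  exact: (measurableT_comp (@measurable_coor _ T2 n i) mf).
rewrite setTI.
suff : measurable `<=` [set B | measurable (f @^-1` B)] by apply.
apply: smallest_sub.
  split => /=; first by rewrite preimage_set0.
    by move=> B mB; rewrite setTD preimage_setC; exact: measurableC.
  by move=> F mF; rewrite preimage_bigcup; exact: bigcup_measurable.
rewrite -bigcup_seq => B [i _] [C mC <-] /=.
rewrite setTI -(setTI (f @^-1` _)).
exact: (mf i measurableT C mC).
Qed.

Section cons_measure_rV.
Context {R : realType} (n : nat).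
Variables (nu : {sigma_finite_measure set (measurableTypeR R) -> \bar R})
  (mu : {sigma_finite_measure set 'rV[R]_n -> \bar R}).

Let cons_rV (p : measurableTypeR R * 'rV[R]_n) : 'rV[R]_n.+1 :=
  row_mx (p.1%:M : 'rV_1) p.2 : 'rV_(1 + n).

Let uncons_rV (v : 'rV[R]_n.+1) : measurableTypeR R * 'rV[R]_n :=
  (v ord0 ord0, \row_j v ord0 (lift ord0 j)).

Let cons_rVK : cancel cons_rV uncons_rV.
Proof.
move=> [t v]; rewrite /uncons_rV /cons_rV; congr pair.
  transitivity (row_mx (t%:M : 'rV_1) v ord0 (lshift n (ord0 : 'I_1))).
    by congr (row_mx _ _ _ _); exact/val_inj.
  by rewrite row_mxEl mxE eqxx mulr1n.
apply/rowP => j; rewrite mxE -[RHS](row_mxEr (t%:M : 'rV_1)).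
by congr (row_mx _ _ _ _); exact/val_inj.
Qed.

Let measurable_cons_rV : measurable_fun [set: measurableTypeR R * 'rV[R]_n] cons_rV.
Proof.
apply/measurable_fun_rVP => i; rewrite /cons_rV.
case: (split_ordP (i : 'I_(1 + n))) => j ->.
  rewrite [X in measurable_fun _ X](_ : _ = fst); first exact: measurable_fst.
  apply/funext => p; transitivity ((p.1%:M : 'rV_1) ord0 j).
    exact: row_mxEl.
  by rewrite mxE (ord1 j) eqxx mulr1n.
rewrite [X in measurable_fun _ X](_ : _ = fun p : measurableTypeR R * 'rV[R]_n => p.2 ord0 j).
  exact: (measurableT_comp (@measurable_coor _ R n j) measurable_snd).
by apply/funext => p; exact: row_mxEr.
Qed.

Let measurable_uncons_rV : measurable_fun [set: 'rV[R]_n.+1] uncons_rV.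
Proof.
apply: measurable_fun_pair; first exact: measurable_coor.
apply/measurable_fun_rVP => i; under eq_fun do rewrite mxE.
exact: measurable_coor.
Qed.

Definition cons_measure_rV : set 'rV[R]_n.+1 -> \bar R :=
  pushforward (nu \x mu)%E cons_rV.

Let rec0 : cons_measure_rV set0 = 0%E.
Proof. by rewrite /cons_measure_rV /pushforward preimage_set0 measure0. Qed.

Let rec_ge0 A : (0 <= cons_measure_rV A)%E.
Proof. exact: measure_ge0. Qed.

Let rec_sigma_additive : semi_sigma_additive cons_measure_rV.
Proof.
move=> F mF tF mUF; rewrite /cons_measure_rV /pushforward.
rewrite preimage_bigcup; apply: measure_semi_sigma_additive.
- by move=> k; rewrite -[X in measurable X]setTI; exact: measurable_cons_rV.
- apply/trivIsetP => /= i j _ _ ij; rewrite -preimage_setI.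
  by move/trivIsetP : tF => /(_ _ _ _ _ ij) ->//; rewrite preimage_set0.
- rewrite -preimage_bigcup -[X in measurable X]setTI.
  exact: measurable_cons_rV.
Qed.

HB.instance Definition _ := isMeasure.Build _ _ _ cons_measure_rV
  rec0 rec_ge0 rec_sigma_additive.

Let rec_sigma_finite : sigma_finite setT cons_measure_rV.
Proof.
have /sigma_finiteP[F [TF ndF Foo]] := sigma_finiteT nu.
have /sigma_finiteP[G [TG ndG Goo]] := sigma_finiteT mu.
exists (fun k => uncons_rV @^-1` (F k `*` G k)).
  rewrite -preimage_bigcup [X in _ @^-1` X](_ : _ = setT) ?preimage_setT//.
  apply/seteqP; split=> // -[x y] _.
  have [i _ Fx] : (\bigcup_i F i) x by rewrite -TF.
  have [j _ Gy] : (\bigcup_i G i) y by rewrite -TG.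
  exists (maxn i j) => //; split => /=.
    by move: x Fx; exact/subsetPset/ndF/leq_maxl.
  by move: y Gy; exact/subsetPset/ndG/leq_maxr.
move=> k; have [mFk Fk] := Foo k; have [mGk Gk] := Goo k; split.
  rewrite -[X in measurable X]setTI; apply: measurable_uncons_rV => //.
  exact: measurableX.
rewrite /cons_measure_rV /pushforward [X in product_measure1 _ _ X](_ : _ = F k `*` G k).
  by rewrite product_measure1E// lte_mul_pinfty// ge0_fin_numE.
by apply/funext => p; exact: (congr1 (F k `*` G k) (cons_rVK p)).
Qed.

HB.instance Definition _ := Measure_isSigmaFinite.Build _ _ _
  cons_measure_rV rec_sigma_finite.

End cons_measure_rV.

(* n-fold product of the one-dimensional Lebesgue measure; a point mass if n = 0 *)
Fixpoint lebesgue_measure_rV {R : realType} (n : nat) :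
    {sigma_finite_measure set 'rV[R]_n -> \bar R} :=
  match n with
  | 0 => (\d_ (0 : 'rV[R]_0))%R
  | m.+1 => cons_measure_rV
      [the {sigma_finite_measure set _ -> \bar R} of @lebesgue_measure R] (lebesgue_measure_rV m)
  end.

Section euclidean.
Context {R : realType} {n : nat}.
Implicit Types u v : 'rV[R]_n.

Definition dotr u v : R := \sum_(i < n) u ord0 i * v ord0 i.

(* The library norm [`|u|] on row vectors is the sup norm. *)
Definition enorm u : R := Num.sqrt (dotr u u).

End euclidean.

Section random_vectors.
Context {R : realType} {n : nat}.

Definition nondegenerate_law (p : probability 'rV[R]_n R) : Prop :=
  forall (v : 'rV[R]_n) (c : R), v != 0 ->
    (p [set x | dotr x v = c] < 1)%E.

Context d {Omega : measurableType d} (P : probability Omega R).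
Implicit Types X Y Z : {RV P >-> 'rV[R]_n}.

Definition independent_RV X Z : Prop :=
  forall A B : set 'rV[R]_n, measurable A -> measurable B ->
    P (X @^-1` A `&` Z @^-1` B) = (P (X @^-1` A) * P (Z @^-1` B))%E.

Definition has_density Z (f : 'rV[R]_n -> R) : Prop :=
  [/\ measurable_fun [set: 'rV[R]_n] f,
      forall z, 0 <= f z &
      forall A : set 'rV[R]_n, measurable A ->
        distribution P Z A = (\int[lebesgue_measure_rV n]_(z in A) (f z)%:E)%E].

(* The constant of proportionality is determined by [has_density]. *)
Definition gaussian_shape (sigma : R) (f : 'rV[R]_n -> R) : Prop :=
  exists c : R, forall z, f z = c * expR (- (enorm z ^+ 2 / (2 * sigma ^+ 2))).

Record gaussian_noise_model (pX : probability 'rV[R]_n R) (sigma : R)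
    X Z Y (pZ : 'rV[R]_n -> R) : Prop := GaussianNoiseModel {
  prior : forall A : set 'rV[R]_n, measurable A -> distribution P X A = pX A;
  independent_noise : independent_RV X Z;
  noise_density : has_density Z pZ;
  noise_gaussian : gaussian_shape sigma pZ;
  additive_noise : forall w, Y w = X w + Z w
}.

Definition expectation_rV (V : Omega -> 'rV[R]_n) : 'rV[R]_n :=
  \row_i fine ('E_P[fun w => V w ord0 i])%E.

(* E(X | Y = y), given pointwise by E_X(X pZ(y - X)) / E_X(pZ(y - X)). For a
   Gaussian [pZ] both integrands are bounded and the denominator is positive,
   so [fine] loses nothing even if X is not integrable. *)
Definition cond_mean X (pZ : 'rV[R]_n -> R) (y : 'rV[R]_n) : 'rV[R]_n :=
  (fine ('E_P[fun w => pZ (y - X w)%R])%E)^-1 *: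
    expectation_rV (fun w => pZ (y - X w) *: X w).

End random_vectors.

Section penalties.
Context {R : realType} {n : nat}.
Implicit Types (phi rho : 'rV[R]_n -> \bar R) (y u : 'rV[R]_n).

(* values in R u {+oo}, not identically +oo *)
Definition proper_penalty phi : Prop :=
  (forall x, phi x != -oo%E) /\ (exists x, phi x != +oo%E).

Definition argmin rho : set 'rV[R]_n := [set u | forall x, (rho u <= rho x)%E].

Definition penalized phi y (x : 'rV[R]_n) : \bar R :=
  ((2^-1 * enorm (y - x) ^+ 2)%:E + phi x)%E.

Definition prox phi y : set 'rV[R]_n := argmin (penalized phi y).

Definition is_prox (f : 'rV[R]_n -> 'rV[R]_n) phi : Prop :=
  forall y, prox phi y = [set f y].

Definition grad (f : 'rV[R]_n -> R) u : 'rV[R]_n :=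
  \row_i 'D_(delta_mx ord0 i) f u.

Definition stationary rho : set 'rV[R]_n :=
  [set u | [/\ \forall x \near u, rho x \is a fin_num,
               differentiable (fine \o rho) u &
               grad (fine \o rho) u = 0]].

End penalties.

(* Main.v *)
(* Put s = sigma^2 and psi y = s ln \int exp ((<x, y> - |x|^2 / 2) / s) dpX(x).
   The conditional mean F is the gradient of the convex function psi. Jensen's
   inequality for exp gives psi z >= psi y + <F y, z - y>, strictly for y != z
   when pX is non-degenerate, and a second order Taylor bound gives
   psi (y + h) <= psi y + <F y, h> + C_y |h|^2 for |h| <= 1; everything else
   follows from these inequalities. The penalty is the Legendre transform of psi
   minus |x|^2 / 2 on the range of F and +oo elsewhere, so that
   |y - F z|^2 / 2 + phi (F z) = |y|^2 / 2 - (psi z + <F z, y - z>)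
   is minimal at z = y. In the non-degenerate case the range of F is open:
   psi - <F y + k, .> attains its minimum over a small ball around y in the
   interior when k is small, which solves F z = F y + k with z close to y. Hence
   the inverse of F is continuous, the penalized function is differentiable at
   F z, and its gradient there is z - y. *)
Require Import Defs.
From HB Require Import structures.
From mathcomp Require Import all_boot all_order all_algebra.
From mathcomp Require Import all_classical all_reals all_analysis.
From mathcomp Require Import measurable_realfun ring lra.

Set Implicit Arguments.
Unset Strict Implicit.
Unset Printing Implicit Defensive.

Import Order.TTheory GRing.Theory Num.Theory.
Import numFieldNormedType.Exports.
Local Open Scope classical_set_scope.
Local Open Scope ring_scope.

(** * Euclidean inner product on row vectors *)

Section dot_product.
Context {R : realType} {n : nat}.
Implicit Types (u v w : 'rV[R]_n) (a : R).

Lemma dotrC u v : dotr u v = dotr v u.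
Proof. by apply: eq_bigr => i _; rewrite mulrC. Qed.

Lemma dotrDl u v w : dotr (u + v) w = dotr u w + dotr v w.
Proof. by rewrite -big_split; apply: eq_bigr => i _; rewrite mxE mulrDl. Qed.

Lemma dotrZl a u v : dotr (a *: u) v = a * dotr u v.
Proof. by rewrite /dotr mulr_sumr; apply: eq_bigr => i _; rewrite mxE mulrA. Qed.

Lemma dotrNl u v : dotr (- u) v = - dotr u v.
Proof. by rewrite -scaleN1r dotrZl mulN1r. Qed.

Lemma dotrBl u v w : dotr (u - v) w = dotr u w - dotr v w.
Proof. by rewrite dotrDl dotrNl. Qed.

Lemma dotrDr u v w : dotr u (v + w) = dotr u v + dotr u w.
Proof. by rewrite dotrC dotrDl !(dotrC u). Qed.

Lemma dotrZr a u v : dotr u (a *: v) = a * dotr u v.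
Proof. by rewrite dotrC dotrZl dotrC. Qed.

Lemma dotrNr u v : dotr u (- v) = - dotr u v.
Proof. by rewrite dotrC dotrNl dotrC. Qed.

Lemma dotrBr u v w : dotr u (v - w) = dotr u v - dotr u w.
Proof. by rewrite dotrDr dotrNr. Qed.

Lemma dotr0 u : dotr u 0 = 0.
Proof. by rewrite -(scale0r 0) dotrZr mul0r. Qed.

Lemma dot0r u : dotr 0 u = 0.
Proof. by rewrite dotrC dotr0. Qed.

Lemma dotr_delta u i : dotr u (delta_mx ord0 i) = u ord0 i.
Proof.
rewrite /dotr (bigD1 i)//= big1 ?addr0 => [|j /negbTE ji].
  by rewrite mxE !eqxx mulr1.
by rewrite mxE ji mulr0.
Qed.

Lemma dotrr_ge0 u : 0 <= dotr u u.
Proof. by apply: sumr_ge0 => i _; rewrite -expr2 sqr_ge0. Qed.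

Lemma dotrr_gt0 u : u != 0 -> 0 < dotr u u.
Proof.
move=> u0; rewrite lt0r dotrr_ge0 andbT; apply: contra u0.
rewrite psumr_eq0 => [/allP u0|i _]; last by rewrite -expr2 sqr_ge0.
apply/eqP/rowP => i; have := u0 i (mem_index_enum _).
by rewrite /= -expr2 sqrf_eq0 mxE => /eqP.
Qed.

Lemma enorm_ge0 u : 0 <= enorm u. Proof. exact: sqrtr_ge0. Qed.

Lemma sqr_enorm u : enorm u ^+ 2 = dotr u u.
Proof. by rewrite sqr_sqrtr// dotrr_ge0. Qed.

(** Expanding the square of |v| u - |u| v gives |u| |v| (|u| |v| - <u, v>) >= 0; the positive factor
    is divided out, hence the separate zero cases. *)
Lemma dotr_le_enorm u v : dotr u v <= enorm u * enorm v.
Proof.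
have [->|u0] := eqVneq u 0.
  by rewrite dot0r mulr_ge0 ?enorm_ge0.
have [->|v0] := eqVneq v 0.
  by rewrite dotr0 mulr_ge0 ?enorm_ge0.
have eu : 0 < enorm u by rewrite sqrtr_gt0 dotrr_gt0.
have ev : 0 < enorm v by rewrite sqrtr_gt0 dotrr_gt0.
have := dotrr_ge0 (enorm v *: u - enorm u *: v).
rewrite !(dotrBl, dotrBr, dotrZl, dotrZr) (dotrC v u) -!sqr_enorm.
have euv := mulr_gt0 eu ev.
set a := enorm u in eu euv *; set b := enorm v in ev euv *; set d := dotr u v => h.
rewrite -subr_ge0 -(pmulr_rge0 _ euv); nra.
Qed.

Lemma normr_dotr u v : `|dotr u v| <= enorm u * enorm v.
Proof.
rewrite ler_norml dotr_le_enorm andbT lerNl -dotrNl.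
by apply: (le_trans (dotr_le_enorm _ _)); rewrite /enorm dotrNl dotrNr opprK.
Qed.

Lemma normr_coord_le (v : 'rV[R]_n) i : `|v ord0 i| <= `|v|.
Proof.
rewrite [leRHS]/Num.Def.normr/= mx_normrE.
by apply: (le_trans _ (le_bigmax _ (fun k => `|v k.1 k.2|) (ord0, i))).
Qed.

(** Topology and derivatives use the sup norm, inner products the Euclidean one; this is the bridge
    between them. *)
Lemma enorm_le_norm v : enorm v <= Num.sqrt n%:R * `|v|.
Proof.
rewrite -(@ler_pXn2r _ 2)// ?nnegrE ?mulr_ge0 ?sqrtr_ge0// sqr_enorm exprMn.
rewrite sqr_sqrtr//.
apply: (@le_trans _ _ (\sum_(i < n) `|v| ^+ 2)).
  apply: ler_sum => i _; rewrite -expr2 -real_normK ?num_real//.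
  by rewrite ler_pXn2r ?nnegrE// normr_coord_le.
by rewrite sumr_const card_ord -[_ ^+ 2 *+ n]mulr_natl.
Qed.

Lemma dotr_is_linear u : linear (dotr u).
Proof. by move=> a v w; rewrite dotrDr dotrZr. Qed.

HB.instance Definition _ u :=
  GRing.isLinear.Build R 'rV[R]_n R _ (dotr u) (dotr_is_linear u).

(** * Neighbourhoods, continuity and gradients in terms of increments *)

Lemma near_rVP (P : 'rV[R]_n -> Prop) v (d : R) :
  0 < d -> (forall h, `|h| < d -> P (v + h)) -> \forall w \near v, P w.
Proof.
move=> d0 dP; apply/nbhs_ballP; exists d => // w; rewrite -ball_normE /= => vw.
by rewrite -(subrKC v w); apply: dP; rewrite distrC.
Qed.

Lemma continuous_enorm_le (f : 'rV[R]_n -> R) v (K : R) :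
    (forall h, enorm h <= 1 -> `|f (v + h) - f v| <= K * enorm h) ->
  {for v, continuous f}.
Proof.
move=> fK; apply/(@cvgrPdist_le _ _ _ (nbhs v) (nbhs_filter v)) => e e0.
(* The added 1 keeps [s] positive when [n] is 0. *)
pose s : R := Num.sqrt n%:R + 1.
have s0 : 0 < s by rewrite ltr_wpDl ?sqrtr_ge0.
have K0 : 0 < `|K| + 1 by rewrite ltr_wpDl.
have d0 : 0 < Num.min 1 (e / (`|K| + 1)) / s.
  by rewrite divr_gt0// lt_min ltr01 divr_gt0.
apply: (near_rVP d0) => h.
rewrite ltr_pdivlMr// mulrC lt_min => /andP[h1 he].
have sh : enorm h <= s * `|h|.
  by apply: (le_trans (enorm_le_norm _)); rewrite ler_wpM2r// lerDl.
rewrite distrC; apply: (le_trans (fK h (le_trans sh (ltW h1)))).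
apply: (@le_trans _ _ ((`|K| + 1) * enorm h)).
  by rewrite ler_wpM2r ?enorm_ge0// (le_trans (ler_norm _))// lerDl.
by rewrite -ler_pdivlMl// mulrC (le_trans sh)// ltW.
Qed.

Lemma dotr_continuous u : continuous (dotr u).
Proof.
move=> v; apply: (continuous_enorm_le (K := enorm u)) => h _.
by rewrite dotrDr addrAC subrr add0r normr_dotr.
Qed.

(** The estimate identifies [dotr w] as the differential by uniqueness; its values on the basis
    vectors are the partial derivatives. *)
Lemma differentiable_dotr (f : 'rV[R]_n -> R) u w :
    (forall e, 0 < e -> exists2 d, 0 < d & forall h, `|h| < d ->
      `|f (u + h) - f u - dotr w h| <= e * `|h|) ->
  differentiable f u /\ grad f u = w.
Proof.
move=> fw.
have fdo : f \o shift u = cst (f u) + dotr w +o_ (0 : 'rV[R]_n) id.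
  apply/eqaddoP => e /fw[d d0 fd]; apply: (near_rVP d0) => h hd /=.
  by rewrite add0r; have := fd h hd; rewrite (addrC u) -addrA -opprD.
have dfE := diff_unique (@dotr_continuous w) fdo.
have df : differentiable f u.
  by apply/diff_locallyP; rewrite dfE; split; [exact: dotr_continuous|].
split=> //; apply/rowP => i; rewrite mxE deriveE// dfE; exact: dotr_delta.
Qed.

Lemma half_sqr_enormB u v :
  2^-1 * enorm (u - v) ^+ 2 =
  2^-1 * dotr u u - dotr u v + 2^-1 * dotr v v.
Proof.
rewrite sqr_enorm !(dotrBl, dotrBr) (dotrC v u); lra.
Qed.

End dot_product.

(** * Proximity operators and strictly convex functions *)

Section gradient_of_convex.
Context {R : realType} {n : nat}.
Variables (psi : 'rV[R]_n -> R) (F : 'rV[R]_n -> 'rV[R]_n).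
Implicit Types u v w y : 'rV[R]_n.

Hypothesis psi_ge : forall y z, psi y + dotr (F y) (z - y) <= psi z.

(** The two subgradient inequalities between [y] and [z] are opposite when [F y = F z]. The common
    value is the Legendre transform of [psi] at [F y]. *)
Lemma dotr_subgradient_eq y z : F y = F z ->
  dotr y (F y) - psi y = dotr z (F y) - psi z.
Proof.
move=> Fyz; have := psi_ge y z; have := psi_ge z y.
rewrite -Fyz !dotrBr !(dotrC (F y)) => h1 h2; apply/eqP; rewrite eq_le; lra.
Qed.

(* By [dotr_subgradient_eq] the value does not depend on the preimage [y]. *)
Definition subgradient_penalty (x : 'rV[R]_n) : \bar R :=
  if pselect (exists y, F y = x) is left e then
    let y := projT1 (cid e) in
    (dotr y x - psi y - 2^-1 * dotr x x)%:E
  else +oo%E.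
Notation phi := subgradient_penalty.

Lemma subgradient_penaltyE y :
  phi (F y) = (dotr y (F y) - psi y - 2^-1 * dotr (F y) (F y))%:E.
Proof.
rewrite /phi; case: pselect => [e|[]]; last by exists y.
case: cid => z /= zy; congr (_ - _)%:E.
by rewrite -zy; exact: dotr_subgradient_eq.
Qed.

Lemma subgradient_penalty_proper : proper_penalty phi.
Proof.
split=> [x|]; last by exists (F 0); rewrite subgradient_penaltyE.
by rewrite /phi; case: pselect.
Qed.

(** The squares of [F z] cancel. What is subtracted is the tangent of [psi] at [z], evaluated at
    [y], so minimizing over the range of [F] means finding the tangent that is highest at [y]. *)
Lemma penalized_subgradientE y z :
  penalized phi y (F z) = (2^-1 * dotr y y - (psi z + dotr (F z) (y - z)))%:E.
Proof.
rewrite /penalized subgradient_penaltyE -EFinD half_sqr_enormB; congr (_%:E).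
rewrite dotrBr !(dotrC (F z)); lra.
Qed.

Lemma penalized_subgradient_pinfty y x :
  ~ (exists z, F z = x) -> penalized phi y x = +oo%E.
Proof.
by move=> Fx; rewrite /penalized /phi; case: pselect => // _; rewrite addeC.
Qed.

Lemma argmin_subgradient y : argmin (penalized phi y) (F y).
Proof.
move=> x; have [[z <-]|Fx] := pselect (exists z, F z = x).
  rewrite !penalized_subgradientE lee_fin subrr lerD2l lerN2.
  by rewrite dotr0 addr0.
by rewrite (penalized_subgradient_pinfty _ Fx) leey.
Qed.

(** * Strict convexity: injectivity and uniqueness of the minimizer *)

Hypothesis psi_gt : forall y z, y != z -> psi y + dotr (F y) (z - y) < psi z.

Lemma strict_subgradient_inj : injective F.
Proof.
move=> y z Fyz; apply/eqP; apply: contraT => yz.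
have := psi_gt yz; rewrite eq_sym in yz; have := psi_gt yz.
rewrite Fyz !dotrBr; lra.
Qed.

Lemma is_prox_subgradient : is_prox F phi.
Proof.
move=> y; apply/seteqP; split=> [x|_ ->]; last exact: argmin_subgradient.
move=> /(_ (F y)).
have [[z <-]|Fx] := pselect (exists z, F z = x); last first.
  by rewrite (penalized_subgradient_pinfty _ Fx) penalized_subgradientE leNgt ltry.
rewrite !penalized_subgradientE lee_fin subrr lerD2l lerN2.
rewrite dotr0 addr0.
have [->//|/psi_gt zy] := eqVneq z y.
by move=> /(lt_le_trans zy); rewrite ltxx.
Qed.

(** * Quadratic upper bound: regularity of [psi] and of the inverse of [F] *)

Hypothesis psi_le : forall y, exists2 C, 0 <= C &
  forall h, dotr h h <= 1 -> psi (y + h) <= psi y + dotr (F y) h + C * dotr h h.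

Lemma subgradient_continuous : continuous psi.
Proof.
move=> y; have [C C0 le_psi] := psi_le y.
apply: (continuous_enorm_le (K := enorm (F y) + C)) => h h1.
have h0 := enorm_ge0 h.
have hh : dotr h h <= enorm h by rewrite -sqr_enorm expr2 ler_piMl.
have := normr_dotr (F y) h; rewrite ler_norml => /andP[Fh1 Fh2].
have Ch : C * dotr h h <= C * enorm h by rewrite ler_wpM2l.
have Ch0 : 0 <= C * enorm h by rewrite mulr_ge0.
have := psi_ge y (y + h); rewrite addrAC subrr add0r => psi1.
have psi2 := le_psi h (le_trans hh h1).
rewrite ler_norml; apply/andP; split; lra.
Qed.

(** [F y] acts as a gradient: if w = u - F y were nonzero, a small step t w would lower psi - <u, .>
    by at least t |w|^2 - C t^2 |w|^2 > 0. *)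
Lemma subgradient_local_min u y r : 0 < r ->
    (forall h, `|h| < r -> psi y - dotr u y <= psi (y + h) - dotr u (y + h)) ->
  F y = u.
Proof.
move=> r0 ymin; apply/esym/eqP; rewrite -subr_eq0; apply: contraT => w0.
set w := u - F y in w0; have ww := dotrr_gt0 w0.
have [C C0 le_psi] := psi_le y.
(* The three bounds keep [t *: w] in the ball, keep its Euclidean square at most 1 and make C t <
   1. *)
pose t := Num.min (r / (2 * `|w|)) (Num.min (1 + dotr w w)^-1 (2 * (C + 1))^-1).
have w1 : 0 < `|w| by rewrite normr_gt0.
have t0 : 0 < t.
  rewrite !lt_min divr_gt0 ?mulr_gt0//= !invr_gt0 addr_gt0//=.
  by rewrite mulr_gt0// ltr_wpDl.
have tr : t * (2 * `|w|) <= r.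
  by rewrite -ler_pdivlMr ?mulr_gt0// ge_min lexx.
have tw : t * (1 + dotr w w) <= 1.
  by rewrite -ler_pdivlMr ?addr_gt0// div1r !ge_min lexx orbT.
have tC : t * (2 * (C + 1)) <= 1.
  rewrite -ler_pdivlMr ?mulr_gt0 ?ltr_wpDl// div1r !ge_min lexx.
  by rewrite !orbT.
have hr : `|t *: w| < r.
  rewrite normrZ gtr0_norm// (lt_le_trans _ tr)// mulrCA ltr_pMl ?ltr1n//.
  by rewrite mulr_gt0.
have tw1 : dotr (t *: w) (t *: w) <= 1.
  by rewrite dotrZl dotrZr; nra.
have := ymin _ hr; have := le_psi _ tw1.
rewrite dotrDr dotrZl !dotrZr => h1 h2.
have h3 : t * dotr w w <= C * (t * (t * dotr w w)).
  have := congr1 ( *%R t) (dotrBl u (F y) w); rewrite -/w mulrBr; lra.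
have h4 : dotr w w <= C * (t * dotr w w).
  by rewrite -(ler_pM2l t0); lra.
nra.
Qed.

(** Besides openness of the range, the preimage is kept within [r] of [y]; as [F] is injective, this
    is continuity of its inverse at [F y]. *)
Lemma strict_subgradient_open y r : 0 < r -> exists2 d, 0 < d &
  forall k, `|k| < d -> exists2 h, `|h| < r & F (y + h) = F y + k.
Proof.
move=> r0; pose p := r / 2; have p0 : 0 < p by rewrite divr_gt0.
(* Removing the slope at [y] makes 0 the strict minimum of [g]. *)
pose g h := psi (y + h) - dotr (F y) h.
have cpsi : continuous (fun h => psi (y + h)).
  move=> h; apply: (@continuous_comp _ _ _ (fun h => y + h) psi h).
    by apply: continuousD; [exact: cst_continuous|exact: cvg_id].
  exact: subgradient_continuous.
have cg : continuous g.
  by move=> h; apply: continuousB; [exact: cpsi|exact: dotr_continuous].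
have compact_le (A : set 'rV[R]_n) : closed A -> (forall h, A h -> `|h| <= p) -> compact A.
  move=> cA Ap; apply: bounded_closed_compact => //.
  exists p; split; first exact: num_real.
  by move=> M pM h /Ap /le_trans; apply; exact: ltW.
have cnorm : continuous (fun h : 'rV[R]_n => `|h|) by exact: norm_continuous.
have [e e0 ge] : exists2 e, 0 < e & forall h, `|h| = p -> g 0 + e <= g h.
  pose S := [set h : 'rV[R]_n | `|h| = p].
  (* The sphere is empty when [n] is 0; any positive [e] then serves. *)
  have [S0|/set0P S0] := eqVneq S set0.
    by exists 1 => // h hp; have : S h by []; rewrite S0.
  have cS : compact S.
    apply: compact_le => [|h /= -> //].
    apply: (closed_comp (f := fun h : 'rV[R]_n => `|h|) (D := [set p])).
      by move=> h _; exact: cnorm.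
    exact: closed_eq.
  have [c cinS gc] := compact_EVT_min S0 cS (continuous_subspaceT cg).
  exists (g c - g 0); last by move=> h hp; rewrite subrKC gc// inE.
  have c0 : c != 0 by rewrite -normr_gt0; move: cinS; rewrite inE /S/= => ->.
  rewrite subr_gt0 /g addr0 dotr0 subr0 ltrBrDr.
  have := @psi_gt y (y + c); rewrite addrAC subrr add0r; apply.
  by rewrite -subr_eq0 opprD addrA subrr add0r oppr_eq0.
have n1 : 0 < n.+1%:R * p by rewrite mulr_gt0.
(* On the sphere <k, h> <= n |k| p in the sup norm, so this bound on [k] keeps the perturbation
   below the gap [e]; n + 1 avoids a division by 0. *)
exists (e / (n.+1%:R * p)) => [|k]; first by rewrite divr_gt0.
rewrite ltr_pdivlMr// => ke.
pose B := [set h : 'rV[R]_n | `|h| <= p].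
have cB : compact B.
  apply: compact_le => [|h //].
  apply: (closed_comp (f := fun h : 'rV[R]_n => `|h|) (D := [set x | x <= p])).
    by move=> h _; exact: cnorm.
  exact: closed_le.
have B0 : B !=set0 by exists 0; rewrite /B/= normr0 ltW.
have cgk : continuous (fun h => g h - dotr k h).
  by move=> h; apply: continuousB; [exact: cg|exact: dotr_continuous].
have [h hB hmin] := compact_EVT_min B0 cB (continuous_subspaceT cgk).
have {}hB : `|h| <= p by move: hB; rewrite inE.
(* A minimizer on the sphere would give e <= <k, h> by comparison with 0. *)
have hp : `|h| < p.
  rewrite lt_neqAle hB andbT; apply/eqP => hp.
  have := hmin 0; rewrite inE /B/= normr0 => /(_ (ltW p0)).
  have := ge _ hp; rewrite dotr0 subr0 => h1 h2.
  have : dotr k h < e.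
    apply: le_lt_trans ke; apply: (le_trans (dotr_le_enorm _ _)).
    rewrite mulrCA -hp.
    apply: (le_trans (ler_pM (enorm_ge0 _) (enorm_ge0 _) (enorm_le_norm _)
      (enorm_le_norm _))).
    rewrite mulrACA -expr2 sqr_sqrtr//.
    by rewrite ler_wpM2r ?mulr_ge0// ler_nat.
  lra.
exists h; first by rewrite (lt_le_trans hp)// /p ler_pdivrMr// ler_pMr// ler1n.
have ph : 0 < p - `|h| by rewrite subr_gt0.
(* The interior minimizer [h] makes [y + h] a local minimizer of psi - <F y + k, .>. *)
apply: (subgradient_local_min ph) => h' h'p.
have := hmin (h + h'); rewrite inE /B/= => /(_ _).
have -> : `|h + h'| <= p by rewrite (le_trans (ler_normD _ _))// -lerBrDl ltW.
move=> /(_ isT); rewrite /g addrA !dotrDl !dotrDr; lra.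
Qed.


Lemma penalized_subgradient_fin y z :
  \forall x \near F z, penalized phi y x \is a fin_num.
Proof.
have [d d0 Fd] := strict_subgradient_open z ltr01.
apply: (near_rVP d0) => k /Fd[h _ <-].
by rewrite penalized_subgradientE.
Qed.

(** With F (z + h) = F z + k, the first order remainder is at most <k, h>, which is o(|k|) because
    [h] tends to 0 with [k]. *)
Lemma penalized_subgradient_diff y z :
  differentiable (fine \o penalized phi y) (F z) /\
  grad (fine \o penalized phi y) (F z) = z - y.
Proof.
apply: differentiable_dotr => e e0.
(* The bound <k, h> <= n |k| |h| in the sup norm turns |h| < e / (n + 1) into the required e |k|. *)
have r0 : 0 < e / n.+1%:R by rewrite divr_gt0.
have [d d0 Fd] := strict_subgradient_open z r0.
exists d => // k kd; have [h hr Fh] := Fd k kd.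
rewrite -Fh /= !penalized_subgradientE /=.
have := psi_ge z (z + h); have := psi_ge (z + h) z.
have -> : z - (z + h) = - h by rewrite opprD addrA subrr add0r.
have -> : z + h - z = h by rewrite addrAC subrr add0r.
(* [E] is a Bregman divergence, nonnegative and at most [dotr k h] by convexity. *)
set E := psi z - psi (z + h) + dotr (F (z + h)) h => h1 h2.
have Ekh : E <= enorm k * enorm h.
  apply: le_trans (dotr_le_enorm k h); rewrite /E Fh dotrDl; lra.
have E0 : 0 <= E by rewrite /E; move: h1; rewrite dotrNr; lra.
rewrite (_ : _ - _ = E); last first.
  by rewrite /E Fh !(dotrBr, dotrDr, dotrDl, dotrNl) (dotrC y k) (dotrC z k); lra.
rewrite ger0_norm//; apply: (le_trans Ekh).
apply: (le_trans (ler_pM (enorm_ge0 _) (enorm_ge0 _) (enorm_le_norm _)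
  (enorm_le_norm _))).
rewrite mulrACA -expr2 sqr_sqrtr// mulrCA [leRHS]mulrC ler_wpM2l//.
apply: (@le_trans _ _ (n.+1%:R * `|h|)); first by rewrite ler_wpM2r// ler_nat.
by rewrite -ler_pdivlMl// mulrC ltW.
Qed.

(** Finiteness near a stationary point puts it in the range of [F], and at [F z] the gradient z - y
    vanishes only for z = y. *)
Lemma subgradient_stationary y : stationary (penalized phi y) = [set F y].
Proof.
apply/seteqP; split=> [x [finx _ gradx]|_ ->] /=; last first.
  have [dF gF] := penalized_subgradient_diff y y.
  by split=> //; [exact: penalized_subgradient_fin|rewrite gF subrr].
have [[z zx]|Fx] := pselect (exists z, F z = x); last first.
  by move: (nbhs_singleton finx); rewrite penalized_subgradient_pinfty.
move: gradx; rewrite -zx; have [_ ->] := penalized_subgradient_diff y z.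
by move=> /eqP; rewrite subr_eq0 => /eqP ->.
Qed.

End gradient_of_convex.

(** * Exponential tilting of a probability law *)

(** Everything comes from (1 - t) e^t <= 1, which is e^(-t) >= 1 - t. The weight e^|t| makes the
    bound on the Taylor remainder valid for both signs. *)
Lemma expR_le_quadratic {R : realType} (t : R) :
  expR t <= 1 + t + t ^+ 2 * expR `|t|.
Proof.
have h1 : (1 - t) * expR t <= 1.
  rewrite -ler_pdivlMr ?expR_gt0// div1r -expRN.
  exact: expR_ge1Dx.
have h2 := expR_ge1Dx t.
have [t0|t0] := leP 0 t.
  by rewrite ger0_norm//; nra.
have := expR_ge1Dx `|t|; rewrite ltr0_norm// => h3.
nra.
Qed.

Lemma sqr_le_expR {R : realType} (t : R) : 0 <= t -> t ^+ 2 <= 2 * expR t.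
Proof.
by move=> t0; have := expR_ge1Dxn 1 t0; rewrite (_ : 2`! = 2%N)//; lra.
Qed.

(** * Real-valued integrals against a probability law *)

Section Rintegral_probability.
Context {d} {T : measurableType d} {R : realType} (p : probability T R).

Lemma bounded_integrable (f : T -> R) (M : R) :
    measurable_fun setT f -> (forall x, `|f x| <= M) ->
  p.-integrable setT (EFin \o f).
Proof.
move=> mf fM; apply: measurable_bounded_integrable => //.
  by rewrite -ge0_fin_numE// fin_num_measure.
by exists M; split; [exact: num_real|move=> L /ltW ML x _; exact: le_trans ML].
Qed.

(** A vanishing integral would make the nonnegative [f] zero almost everywhere. The hypothesis on
    the zero set has the shape of [nondegenerate_law]. *)
Lemma Rintegral_gt0 (f : T -> R) :
    p.-integrable setT (EFin \o f) -> (forall x, 0 <= f x) ->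
  (p [set x | (f x = 0)%R] < 1)%E -> 0 < \int[p]_x f x.
Proof.
move=> intf f0 pf; rewrite lt0r Rintegral_ge0 ?andbT//.
apply/eqP => If0; move: pf; rewrite ltNge => /negP; apply.
have mf := measurable_int _ intf.
have /(ae_eq_integral_abs p measurableT mf)[A [mA pA fA]] :
    (\int[p]_x `|(EFin \o f) x| = 0)%E.
  under eq_integral => x _ do rewrite /= ger0_norm//.
  rewrite -[LHS]fineK; first by rewrite [fine _]If0.
  exact: integrable_fin_num.
have mf0 : measurable [set x | f x = 0].
  move/(proj1 (measurable_EFinP _ _)) : mf => mf.
  have := mf measurableT [set 0] (measurable_set1 _).
  by rewrite setTI.
have -> : [set x | f x = 0] = ~` ~` [set x | f x = 0] by rewrite setCK.
rewrite probability_setC; last exact: measurableC.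
rewrite (_ : p _ = 0) ?sube0//.
apply: (subset_measure0 _ mA _ pA) => //; first exact: measurableC.
by move=> x /= fx; apply: fA => /= /(_ I)[].
Qed.

End Rintegral_probability.

(** * Functions of at most exponential growth *)

Section subexponential.
Context {R : realType} {n : nat}.
Implicit Types (f g : 'rV[R]_n -> R).

Lemma measurable_dotrl w : measurable_fun setT (fun x : 'rV[R]_n => dotr x w).
Proof.
apply: measurable_sum => i; apply: measurable_funM => //.
exact: measurable_coor.
Qed.

Lemma measurable_dotrr : measurable_fun setT (fun x : 'rV[R]_n => dotr x x).
Proof.
by apply: measurable_sum => i; apply: measurable_funM => //; exact: measurable_coor.
Qed.

Lemma measurable_enorm : measurable_fun setT (@enorm R n).
Proof.
apply: measurableT_comp measurable_dotrr.
by apply: continuous_measurable_fun; exact: sqrt_continuous.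
Qed.

(** A class of integrands, stable under linear combinations, that the Gaussian weight makes bounded
    and hence integrable for every law. *)
Definition subexp f := measurable_fun setT f /\
  exists K a, forall x, `|f x| <= K * expR (a * enorm x).

Lemma subexp_cst c : subexp (fun=> c).
Proof.
split; first exact: measurable_cst.
by exists `|c|, 0 => x; rewrite mul0r expR0 mulr1.
Qed.

Lemma subexpD f g : subexp f -> subexp g -> subexp (fun x => f x + g x).
Proof.
move=> [mf [K [a fK]]] [mg [L [b gL]]]; split; first exact: measurable_funD.
exists (K + L), (Num.max a b) => x; rewrite (le_trans (ler_normD _ _))// mulrDl.
have cst_ge0 (C e : R) (r : R) : `|r| <= C * expR e -> 0 <= C.
  by move=> /(le_trans (normr_ge0 _)); rewrite pmulr_lge0// expR_gt0.
apply: lerD.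
  apply: (le_trans (fK x)); rewrite ler_wpM2l ?(cst_ge0 _ _ _ (fK x))//.
  by rewrite ler_expR ler_wpM2r ?enorm_ge0// le_max lexx.
apply: (le_trans (gL x)); rewrite ler_wpM2l ?(cst_ge0 _ _ _ (gL x))//.
by rewrite ler_expR ler_wpM2r ?enorm_ge0// le_max lexx orbT.
Qed.

Lemma subexpZ c f : subexp f -> subexp (fun x => c * f x).
Proof.
move=> [mf [K [a fK]]]; split; first exact: measurable_funM.
by exists (`|c| * K), a => x; rewrite normrM -mulrA ler_wpM2l.
Qed.

Lemma subexp_dotr w : subexp (fun x => dotr x w).
Proof.
split; first exact: measurable_dotrl.
exists (enorm w), 1 => x; apply: (le_trans (normr_dotr _ _)).
rewrite mulrC ler_wpM2l ?enorm_ge0// mul1r (le_trans _ (expR_ge1Dx _))//.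
by rewrite lerDr.
Qed.

Lemma subexp_expR w : subexp (fun x => expR (dotr x w)).
Proof.
split; first exact: measurableT_comp (measurable_dotrl w).
exists 1, (enorm w) => x; rewrite mul1r ger0_norm ?expR_ge0// ler_expR mulrC.
exact: dotr_le_enorm.
Qed.

(** This function weights the second order remainder in [log_partition_le]; the square is absorbed
    by raising the exponent by 1. *)
Lemma subexp_sqr_enorm a : subexp (fun x => enorm x ^+ 2 * expR (a * enorm x)).
Proof.
split.
  apply: measurable_funM; first exact: measurable_funX measurable_enorm.
  apply: measurableT_comp => //; apply: measurable_funM => //.
  exact: measurable_enorm.
exists 2, (1 + a) => x; rewrite ger0_norm ?mulr_ge0 ?expR_ge0 ?sqr_ge0 ?enorm_ge0//.
rewrite [(1 + a) * _]mulrDl mul1r expRD mulrA ler_wpM2r ?expR_ge0//.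
by apply: sqr_le_expR; exact: enorm_ge0.
Qed.

End subexponential.

(** * Gaussian tilting of the prior and its log-partition function *)

Section gaussian_tilt.
Context {R : realType} {n : nat}.
Variables (p : probability 'rV[R]_n R) (s : R).
Hypothesis s_gt0 : 0 < s.
Implicit Types (y z w : 'rV[R]_n) (f g : 'rV[R]_n -> R).

(** Up to a factor depending on [y] and [s] only, this is the centred Gaussian density of variance
    [s] at [y - x]. *)
Definition tilt y (x : 'rV[R]_n) : R :=
  expR ((dotr x y - 2^-1 * dotr x x) / s).

Definition tilted_integral y f : R := \int[p]_x (tilt y x * f x).
Notation T := tilted_integral.

Definition partition_fun y : R := T y (fun=> 1).

(** A scaled cumulant generating function, with [tilted_mean] as its gradient. *)
Definition log_partition y : R := s * ln (partition_fun y).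

Definition tilted_mean y : 'rV[R]_n :=
  (partition_fun y)^-1 *: \row_i T y (fun x => x ord0 i).

Lemma measurable_tilt y f : measurable_fun setT f ->
  measurable_fun setT (fun x => tilt y x * f x).
Proof.
move=> mf; apply: measurable_funM => //; apply: measurableT_comp => //.
apply: measurable_funM => //; apply: measurable_funB.
  exact: measurable_dotrl.
by apply: measurable_funM => //; exact: measurable_dotrr.
Qed.

Lemma tilt_subexp_bounded y f : subexp f ->
  exists M, forall x, `|tilt y x * f x| <= M.
Proof.
move=> [_ [K [a fK]]]; pose b := enorm y / s + a.
have K0 : 0 <= K.
  by have := le_trans (normr_ge0 _) (fK 0); rewrite pmulr_lge0// expR_gt0.
(* The exponent is at most b |x| - |x|^2 / (2 s), a quadratic in |x| that never exceeds s b^2 /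
   2. *)
exists (K * expR (s * b ^+ 2 / 2)) => x.
rewrite normrM ger0_norm ?expR_ge0//.
apply: (le_trans (ler_wpM2l (expR_ge0 _) (fK x))).
rewrite mulrCA -expRD ler_wpM2l// ler_expR -sqr_enorm.
apply: (@le_trans _ _ (b * enorm x - enorm x ^+ 2 / (2 * s))).
  have : dotr x y / s <= enorm y / s * enorm x.
    by rewrite mulrAC ler_pM2r ?invr_gt0// mulrC dotr_le_enorm.
  by rewrite /b mulrBl mulrDl invfM; lra.
rewrite -subr_ge0 (_ : _ - _ = (s * b - enorm x) ^+ 2 / (2 * s)).
  by rewrite divr_ge0 ?sqr_ge0// mulr_ge0// ltW.
field; exact: lt0r_neq0.
Qed.

Lemma tilt_integrable y f : subexp f ->
  p.-integrable setT (EFin \o (fun x => tilt y x * f x)).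
Proof.
move=> sf; have [M fM] := tilt_subexp_bounded y sf.
by apply: bounded_integrable fM; apply: measurable_tilt; case: sf.
Qed.

Lemma eq_tilted_integral y f g : f =1 g -> T y f = T y g.
Proof. by move=> /funext ->. Qed.

Lemma tilted_integralD y f g : subexp f -> subexp g ->
  T y (fun x => f x + g x) = T y f + T y g.
Proof.
move=> sf sg; rewrite -RintegralD//; [|exact: tilt_integrable..].
by apply: eq_Rintegral => x _; rewrite mulrDr.
Qed.

Lemma tilted_integralZ y c f : subexp f -> T y (fun x => c * f x) = c * T y f.
Proof.
move=> sf; rewrite -RintegralZl//; last exact: tilt_integrable.
by apply: eq_Rintegral => x _; rewrite mulrCA.
Qed.

Lemma tilted_integral_cst y c : T y (fun=> c) = c * partition_fun y.
Proof.
rewrite -tilted_integralZ; last exact: subexp_cst.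
by apply: eq_tilted_integral => x; rewrite mulr1.
Qed.

Lemma le_tilted_integral y f g : subexp f -> subexp g ->
  (forall x, f x <= g x) -> T y f <= T y g.
Proof.
move=> sf sg fg; apply: le_Rintegral => //; [exact: tilt_integrable..|].
by move=> x _; rewrite ler_wpM2l ?expR_ge0.
Qed.

Lemma tilted_integral_gt0 y f : subexp f -> (forall x, 0 <= f x) ->
  (p [set x | (f x = 0)%R] < 1)%E -> 0 < T y f.
Proof.
move=> sf f0 pf; apply: Rintegral_gt0; first exact: tilt_integrable.
  by move=> x; rewrite mulr_ge0 ?expR_ge0.
congr (p _ < _)%E : pf; apply/seteqP; split => x /= => [->|/eqP].
  by rewrite mulr0.
by rewrite mulf_eq0 gt_eqF ?expR_gt0// => /eqP.
Qed.

Lemma partition_gt0 y : 0 < partition_fun y.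
Proof.
apply: tilted_integral_gt0 => //; first exact: subexp_cst.
rewrite (_ : [set _ | _] = set0) ?measure0//.
by apply/seteqP; split => // x /= /eqP; rewrite oner_eq0.
Qed.

Lemma subexp_coord i : subexp (fun x : 'rV[R]_n => x ord0 i).
Proof.
rewrite (_ : (fun _ => _) = fun x => dotr x (delta_mx ord0 i)).
  exact: subexp_dotr.
by apply/funext => x; rewrite dotr_delta.
Qed.

Lemma tilted_integral_dotr y w :
  T y (fun x => dotr x w) = partition_fun y * dotr (tilted_mean y) w.
Proof.
rewrite /tilted_mean dotrZl mulVKf; last by rewrite gt_eqF// partition_gt0.
rewrite /dotr; under [RHS]eq_bigr => i _ do rewrite mxE.
(* The induction carries [subexp] along because additivity of the integral requires it. *)
suff : forall r : seq 'I_n, subexp (fun x => \sum_(i <- r) x ord0 i * w ord0 i) /\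
    T y (fun x => \sum_(i <- r) x ord0 i * w ord0 i) =
    \sum_(i <- r) T y (fun x => x ord0 i) * w ord0 i by move=> /(_ (index_enum 'I_n))[].
elim=> [|i r [sr IH]].
  under eq_fun do rewrite big_nil.
  by rewrite big_nil tilted_integral_cst mul0r; split=> //; exact: subexp_cst.
have si : subexp (fun x : 'rV[R]_n => x ord0 i * w ord0 i).
  under eq_fun do rewrite mulrC.
  by apply: subexpZ; exact: subexp_coord.
under eq_fun do rewrite big_cons.
split; first exact: subexpD.
rewrite big_cons tilted_integralD// IH; congr (_ + _).
rewrite mulrC -tilted_integralZ; last exact: subexp_coord.
by apply: eq_tilted_integral => x; rewrite mulrC.
Qed.

(** A shift of the parameter becomes an exponential factor, so that all comparisons are made under
    the weight at [y]. *)
Lemma tiltD y h f :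
  T (y + h) f = T y (fun x => expR (dotr x (s^-1 *: h)) * f x).
Proof.
apply: eq_Rintegral => x _; rewrite mulrA -expRD; congr (expR _ * _).
rewrite dotrDr dotrZr; lra.
Qed.

Lemma partitionD y h :
  partition_fun (y + h) = T y (fun x => expR (dotr x (s^-1 *: h))).
Proof. by rewrite /partition_fun tiltD; apply: eq_tilted_integral => x; rewrite mulr1. Qed.

(** * Supporting hyperplanes of the log-partition function *)

Section jensen.
Variables y h : 'rV[R]_n.
Let v := s^-1 *: h.
Let a := dotr (tilted_mean y) v.
(* Affine minorant of [expR (dotr x v)], tangent at the tilted mean of [dotr x v]. *)
Let tangent x := expR a * (1 - a) + expR a * dotr x v.

Let subexp_tangent : subexp tangent.
Proof. by apply: subexpD; [exact: subexp_cst|apply: subexpZ; exact: subexp_dotr]. Qed.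

Let tangent_integral : T y tangent = expR a * partition_fun y.
Proof.
rewrite tilted_integralD; [|exact: subexp_cst|apply: subexpZ; exact: subexp_dotr].
rewrite tilted_integral_cst tilted_integralZ; last exact: subexp_dotr.
by rewrite tilted_integral_dotr -/a; ring.
Qed.

(** This exhibits the gap in Jensen's inequality as nonnegative, and zero exactly where
    [dotr x v = a]. *)
Let expR_tangent x : expR (dotr x v) - tangent x =
  expR a * (expR (dotr x v - a) - (1 + (dotr x v - a))).
Proof.
by rewrite /tangent [in RHS]mulrBr -expRD subrKC; ring.
Qed.

Let log_partition_shift : log_partition y + dotr (tilted_mean y) h =
  s * ln (T y tangent).
Proof.
rewrite tangent_integral lnM ?posrE ?expR_gt0 ?partition_gt0// expRK.
by rewrite mulrDr addrC /a /v dotrZr mulVKf// gt_eqF.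
Qed.

(** The exponential lies above [tangent], whose tilted integral yields the left-hand side after
    [ln]. *)
Lemma log_partition_ge :
  log_partition y + dotr (tilted_mean y) h <= log_partition (y + h).
Proof.
rewrite log_partition_shift /log_partition partitionD ler_pM2l//.
rewrite ler_ln ?posrE -?partitionD ?partition_gt0//; last first.
  by rewrite tangent_integral mulr_gt0 ?expR_gt0 ?partition_gt0.
rewrite partitionD; apply: le_tilted_integral => //; first exact: subexp_expR.
by move=> x; rewrite -subr_ge0 expR_tangent mulr_ge0 ?expR_ge0// subr_ge0 expR_ge1Dx.
Qed.

Lemma log_partition_gt : nondegenerate_law p -> h != 0 ->
  log_partition y + dotr (tilted_mean y) h < log_partition (y + h).
Proof.
move=> pnd h0.
have v0 : v != 0 by rewrite scaler_eq0 invr_eq0 gt_eqF.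
rewrite log_partition_shift /log_partition partitionD ltr_pM2l//.
rewrite ltr_ln ?posrE -?partitionD ?partition_gt0//; last first.
  by rewrite tangent_integral mulr_gt0 ?expR_gt0 ?partition_gt0.
rewrite partitionD -subr_gt0 -mulN1r -tilted_integralZ// -tilted_integralD//;
  [|exact: subexp_expR|exact: subexpZ].
apply: tilted_integral_gt0.
- by apply: subexpD; [exact: subexp_expR|exact: subexpZ].
- by move=> x; rewrite mulN1r expR_tangent mulr_ge0 ?expR_ge0// subr_ge0 expR_ge1Dx.
(* The gap vanishes exactly on an affine hyperplane, which has probability below 1. *)
- apply: le_lt_trans (pnd v a v0); rewrite le_eqVlt; apply/orP; left; apply/eqP.
  congr (p _); apply/seteqP; split=> x /=; rewrite mulN1r expR_tangent.
    move=> /eqP; rewrite mulf_eq0 gt_eqF ?expR_gt0//= subr_eq0 => /eqP xa.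
    apply/eqP; rewrite -subr_eq0; apply: contraT => /expR_gt1Dx.
    by rewrite xa ltxx.
  by move=> ->; rewrite subrr expR0 addr0 subrr mulr0.
Qed.

End jensen.

(** [expR_le_quadratic] at t = <x, h> / s, where |t| <= |x| / s, is integrated under the tilted
    weight; [C] comes from the integral of the remainder. *)
Lemma log_partition_le y : exists2 C, 0 <= C & forall h, dotr h h <= 1 ->
  log_partition (y + h) <=
  log_partition y + dotr (tilted_mean y) h + C * dotr h h.
Proof.
pose f (x : 'rV[R]_n) := enorm x ^+ 2 * expR (s^-1 * enorm x).
have sf : subexp f by exact: subexp_sqr_enorm.
pose C := T y f / partition_fun y / s.
have L0 := partition_gt0 y.
have Tf0 : 0 <= T y f.
  by apply: Rintegral_ge0 => x _; rewrite /f !mulr_ge0 ?expR_ge0 ?enorm_ge0.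
exists C => [|h h1]; first by rewrite !divr_ge0// ltW.
pose v := s^-1 *: h.
pose q (x : 'rV[R]_n) := 1 + dotr x v + s^-2 * dotr h h * f x.
have sq : subexp q.
  apply: subexpD; last exact: subexpZ.
  by apply: subexpD; [exact: subexp_cst|exact: subexp_dotr].
have expq x : expR (dotr x v) <= q x.
  apply: (le_trans (expR_le_quadratic _)); rewrite lerD2l.
  have xv : `|dotr x v| <= s^-1 * (enorm x * enorm h).
    by rewrite dotrZr normrM gtr0_norm ?invr_gt0// ler_pM2l ?invr_gt0// normr_dotr.
  have h1' : enorm h <= 1.
    by rewrite -(@ler_pXn2r _ 2) ?nnegrE ?enorm_ge0// sqr_enorm expr1n.
  rewrite /f mulrA; apply: ler_pM; rewrite ?sqr_ge0 ?expR_ge0//.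
    rewrite -sqr_enorm mulrAC -mulrA -exprVn -!exprMn.
    rewrite -[leLHS]real_normK ?num_real// ler_pXn2r ?nnegrE//.
    by rewrite !mulr_ge0 ?enorm_ge0 ?invr_ge0 ?ltW.
  rewrite ler_expR; apply: (le_trans xv); rewrite ler_pM2l ?invr_gt0//.
  by rewrite ler_piMr ?enorm_ge0.
have Tq : T y q = partition_fun y * (1 + s^-1 * (dotr (tilted_mean y) h + C * dotr h h)).
  rewrite tilted_integralD; [|by apply: subexpD; [exact: subexp_cst|exact: subexp_dotr]
    |exact: subexpZ].
  rewrite tilted_integralD; [|exact: subexp_cst|exact: subexp_dotr].
  rewrite tilted_integral_cst tilted_integral_dotr tilted_integralZ// dotrZr /C.
  by field; rewrite !gt_eqF.
have Lq : partition_fun (y + h) <= T y q.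
  by rewrite partitionD; apply: le_tilted_integral => //; exact: subexp_expR.
rewrite /log_partition -addrA -ler_pdivlMl// mulrDr mulKf ?gt_eqF//.
rewrite -lerBlDl -ln_div ?posrE ?partition_gt0//.
set r := _ / _; have r0 : 0 < r by rewrite divr_gt0 ?partition_gt0.
(* The inequality ln r <= r - 1 removes the logarithm without changing the first order term. *)
apply: (@le_trans _ _ (r - 1)).
  by rewrite -[r in ln r](subrKC 1) le_ln1Dx// ltrBrDr addrC subrr.
by rewrite lerBlDl ler_pdivrMr// mulrC -Tq.
Qed.

End gaussian_tilt.

(** * The conditional mean as a tilted mean *)

Section gaussian_cond_mean.
Context {R : realType} {n : nat} d {Omega : measurableType d}.
Variables (P : probability Omega R) (X : {RV P >-> 'rV[R]_n}).
Variables (pX : probability 'rV[R]_n R).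
Hypothesis X_pX :
  forall A : set 'rV[R]_n, measurable A -> distribution P X A = pX A.

(** Transfer to the law makes the conditional mean independent of the probability space that carries
    [X]. *)
Lemma Rintegral_law (f : 'rV[R]_n -> R) (M : R) :
    measurable_fun setT f -> (forall x, `|f x| <= M) ->
  \int[P]_w f (X w) = \int[pX]_x f x.
Proof.
move=> mf fM; congr fine.
rewrite -[LHS](@integral_distribution _ _ _ _ _ _ X (EFin \o f)).
- by apply: eq_measure_integral => A mA _; exact: X_pX.
- exact/measurable_EFinP.
- apply: (bounded_integrable P (f := f \o X) (M := M)).
  by apply: measurableT_comp.
  by move=> w; exact: fM.
Qed.

(** With c = 0 the density would integrate to 0 and not to 1. *)
Lemma gaussian_density_neq0 sigma (Z : {RV P >-> 'rV[R]_n}) c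
    (pZ : 'rV[R]_n -> R) : has_density Z pZ ->
  (forall z, pZ z = c * expR (- (enorm z ^+ 2 / (2 * sigma ^+ 2)))) -> c != 0.
Proof.
move=> [_ _ /(_ _ measurableT)]; rewrite probability_setT => intZ pZE.
apply/eqP => c0; move: intZ; rewrite integral0_eq => [/eqP|z _].
  by rewrite eqe oner_eq0.
by rewrite pZE c0 mul0r.
Qed.

Lemma cond_mean_tilted sigma (Z Y : {RV P >-> 'rV[R]_n}) (pZ : 'rV[R]_n -> R) y :
  0 < sigma -> gaussian_noise_model pX sigma X Z Y pZ ->
  cond_mean X pZ y = tilted_mean pX (sigma ^+ 2) y.
Proof.
move=> sigma0 [_ _ dZ [c pZE] _].
have s0 : 0 < sigma ^+ 2 by rewrite exprn_gt0.
(* Completing the square: [k] collects the factors that do not depend on [x] and cancels in the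
   quotient. *)
pose k := c * expR (- (2^-1 * dotr y y / sigma ^+ 2)).
have k0 : k != 0.
  by rewrite mulf_neq0 ?(gaussian_density_neq0 dZ pZE)// gt_eqF ?expR_gt0.
have pZy x : pZ (y - x) = k * tilt (sigma ^+ 2) y x.
  rewrite pZE /k /tilt -mulrA -expRD; congr (_ * expR _).
  rewrite invfM mulrA [_ ^+ 2 / 2]mulrC half_sqr_enormB (dotrC y x); lra.
have Ek (f : 'rV[R]_n -> R) : subexp f ->
    fine 'E_P[fun w => (pZ (y - X w) * f (X w))%R]%E =
    k * tilted_integral pX (sigma ^+ 2) y f.
  move=> sf; rewrite -tilted_integralZ//.
  have sk : subexp (fun x => k * f x) by exact: subexpZ.
  have [M fM] := tilt_subexp_bounded s0 y sk.
  have := Rintegral_law _ fM; rewrite /tilted_integral => <-; last first.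
    by apply: measurable_tilt; case: sk.
  rewrite unlock; congr fine; apply: eq_integral => w _; congr _%:E.
  by rewrite pZy; ring.
rewrite /cond_mean /tilted_mean.
have -> : fine 'E_P[fun w => pZ (y - X w)%R]%E = k * partition_fun pX (sigma ^+ 2) y.
  rewrite -Ek; last exact: subexp_cst.
  by congr (fine 'E_P[_]%E); apply/funext => w; rewrite mulr1.
have -> : expectation_rV P (fun w => pZ (y - X w) *: X w) =
    k *: \row_i tilted_integral pX (sigma ^+ 2) y (fun x => x ord0 i).
  apply/rowP => i; rewrite !mxE -Ek; last exact: subexp_coord.
  by congr (fine 'E_P[_]%E); apply/funext => w; rewrite mxE.
by rewrite scalerA invfM mulrAC mulVf// mul1r.
Qed.

End gaussian_cond_mean.

Theorem proposition3 (R : realType) (n : nat) (sigma : R)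
    (pX : probability 'rV[R]_n R) :
  0 < sigma ->
  (exists phi : 'rV[R]_n -> \bar R,
    proper_penalty phi /\
    forall (d : measure_display) (Omega : measurableType d)
      (P : probability Omega R) (X Z Y : {RV P >-> 'rV[R]_n})
      (pZ : 'rV[R]_n -> R),
      gaussian_noise_model pX sigma X Z Y pZ ->
      forall y, argmin (penalized phi y) (cond_mean X pZ y)) /\
  (nondegenerate_law pX ->
    (forall (d : measure_display) (Omega : measurableType d)
       (P : probability Omega R) (X Z Y : {RV P >-> 'rV[R]_n})
       (pZ : 'rV[R]_n -> R),
       gaussian_noise_model pX sigma X Z Y pZ ->
       injective (cond_mean X pZ)) /\
    exists phi : 'rV[R]_n -> \bar R,
      proper_penalty phi /\
      forall (d : measure_display) (Omega : measurableType d)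
        (P : probability Omega R) (X Z Y : {RV P >-> 'rV[R]_n})
        (pZ : 'rV[R]_n -> R),
        gaussian_noise_model pX sigma X Z Y pZ ->
        (forall y,
           stationary (penalized phi y) = [set cond_mean X pZ y] /\
           argmin (penalized phi y) (cond_mean X pZ y)) /\
        is_prox (cond_mean X pZ) phi).
Proof.
move=> sigma0; have s0 : 0 < sigma ^+ 2 by rewrite exprn_gt0.
pose psi := log_partition pX (sigma ^+ 2); pose F := tilted_mean pX (sigma ^+ 2).
have psi_ge y z : psi y + dotr (F y) (z - y) <= psi z.
  by rewrite -[z in leRHS](subrKC y); exact: log_partition_ge.
(* Every model yields the same [F], so one penalty can be fixed before the probability space is
   given. *)
have cond_meanE d (Omega : measurableType d) (P : probability Omega R)
    (X Z Y : {RV P >-> 'rV[R]_n}) pZ :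
    gaussian_noise_model pX sigma X Z Y pZ -> cond_mean X pZ = F.
  move=> model; apply/funext => y; have [law _ _ _ _] := model.
  exact: (cond_mean_tilted law y sigma0 model).
have proper := subgradient_penalty_proper psi_ge.
split.
  exists (subgradient_penalty psi F); split=> // d Omega P X Z Y pZ /cond_meanE ->.
  exact: argmin_subgradient.
move=> pX_nd.
have psi_gt y z : y != z -> psi y + dotr (F y) (z - y) < psi z.
  move=> yz; rewrite -[z in ltRHS](subrKC y); apply: log_partition_gt => //.
  by rewrite subr_eq0 eq_sym.
split=> [d Omega P X Z Y pZ /cond_meanE ->|].
  exact: strict_subgradient_inj psi_gt.
exists (subgradient_penalty psi F); split=> // d Omega P X Z Y pZ /cond_meanE ->.
split=> [y|]; last exact: is_prox_subgradient.
split; last exact: argmin_subgradient.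
by apply: subgradient_stationary => // z; exact: log_partition_le.
Qed.
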